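(* Let $G$ be a graph and let $F:V(G)\to 2^{\mathbb{N}}$ where $|F(v)|\leq\frac{1}{2}d(v)$ for all $v\in V(G)$. If, for every $v\in V(G)$, every hole of $v$ is an end-interval of $v$, then $G$ admits an $F$-avoiding orientation.
   Context: All graphs are finite and loopless; parallel edges are permitted, and the degree $d(v)$ of a vertex $v$ of $G$ counts edges with multiplicity. $\mathbb{N}$ includes $0$, and $2^{\mathbb{N}}$ is the set of all subsets of $\mathbb{N}$. For each vertex $v$, the set $\{0,\ldots,d(v)\}$ is partitioned into maximal intervals (of consecutive integers) contained in $F(v)$, called the holes of $v$, and maximal intervals disjoint from $F(v)$, called the homes of $v$. The end-intervals of $v$ are those holes or homes containing $0$ or $d(v)$; each vertex has two end-intervals, which need not be distinct. An orientation $D$ of $G$ assigns a direction to each edge, so that each edge points out of one endpoint and into the other; $d_D^+(v)$ is the number of edges pointing out of $v$. The orientation $D$ is $F$-avoiding if $d_D^+(v)\notin F(v)$ for all $v\in V(G)$. *)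

(* Defs.v *)
From mathcomp Require Import all_boot finmap.
From mathcomp Require Import boolp classical_sets functions cardinality.

Set Implicit Arguments.
Unset Strict Implicit.
Unset Printing Implicit Defensive.

(* A finite loopless graph; distinct edges may have the same pair of ends. *)
Record multigraph := Multigraph {
  vertex : finType;
  edge : finType;
  ends : edge -> {set vertex};
  card_ends : forall e, #|ends e| = 2
}.

Definition deg (G : multigraph) (v : vertex G) : nat :=
  #|[pred e : edge G | v \in ends e]|.

(* Each edge e points out of tail e and into head e; by card_ends these two
   vertices are distinct. *)
Record orientation (G : multigraph) := Orientation {
  tail : edge G -> vertex G;
  head : edge G -> vertex G;
  orient_ends : forall e, ends e = [set tail e; head e]%SET
}.

Definition outdeg (G : multigraph) (D : orientation G) (v : vertex G) : nat :=
  #|[pred e : edge G | tail D e == v]|.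

Section Intervals.
Local Open Scope classical_set_scope.

(* Nonempty intervals of consecutive integers in {0, ..., d}. *)
Definition interval_upto (d : nat) (I : set nat) : Prop :=
  exists a b : nat, a <= b <= d /\ I = [set k | a <= k <= b].

Definition maximal_interval (d : nat) (P : set nat -> Prop) (I : set nat) :
    Prop :=
  [/\ interval_upto d I, P I &
      forall J, interval_upto d J -> P J -> I `<=` J -> J = I].

Definition hole (G : multigraph) (F : vertex G -> set nat) (v : vertex G)
    (I : set nat) : Prop :=
  maximal_interval (deg v) (fun J => J `<=` F v) I.

Definition home (G : multigraph) (F : vertex G -> set nat) (v : vertex G)
    (I : set nat) : Prop :=
  maximal_interval (deg v) (fun J => J `&` F v = set0) I.

Definition end_interval (G : multigraph) (F : vertex G -> set nat)
    (v : vertex G) (I : set nat) : Prop :=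
  (hole F v I \/ home F v I) /\ (I 0 \/ I (deg v)).

Definition avoiding (G : multigraph) (F : vertex G -> set nat)
    (D : orientation G) : Prop :=
  forall v, ~ F v (outdeg D v).

End Intervals.

(* |A| <= n / 2.  Finiteness is stated separately because fset_set A is empty
   when A is infinite. *)
Definition card_le_half (A : set nat) (n : nat) : Prop :=
  finite_set A /\ 2 * #|` fset_set A | <= n.

(* Main.v *)
Require Import Defs.
From mathcomp Require Import all_boot finmap.
From mathcomp Require Import boolp classical_sets functions cardinality.
From mathcomp Require Import order ssralg ssrnum ssrint zify.

(** Every multigraph has a balanced orientation: one in which the outdegree and
    the indegree of each vertex differ by at most one ([balanced_orientation]).
    Such an orientation avoids [F].  Indeed, if the outdegree [k] of [v] were
    in [F v], the hole of [v] containing [k] would be an end-interval, so [F v]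
    would contain all of [0, ..., k] or all of [k, ..., deg v]
    ([hole_end_segment]).  As [k] is within 1/2 of [deg v / 2], either of these
    segments has more than [deg v / 2] elements, against the bound on [F v].

    Balanced orientations come from a signing lemma ([balanced_signing]).
    Record an edge [xy] as the integer vector that is 1 at [x], -1 at [y] and 0
    elsewhere; orienting the edge means choosing a sign for this vector, and
    the signed sum of all vectors is outdegree minus indegree.  If two edges
    [uv] and [vw] meet in [v], they are replaced by the single edge [uw]: an
    orientation of [uw] is extended to a passage through [v], which does not
    change the signed sum.  This repeats until no two edges meet, and then
    every orientation is balanced. *)

Set Implicit Arguments.
Unset Strict Implicit.
Unset Printing Implicit Defensive.

Import Order.TTheory GRing.Theory Num.Theory.

(** * Balanced signings of edge vectors *)

Section Signing.
Local Open Scope ring_scope.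

(** The differences of two unit vectors, together with 0 (the vector of a
    loop).  This form makes the class visibly closed under the splitting of two
    edges at a common end, without naming the ends. *)
Definition edge_vector (V : finType) (c : V -> int) : Prop :=
  \sum_v c v = 0 /\ \sum_v `|c v| <= 2.

(** The entries sum to 0, so [c v] is balanced by the other entries, and its
    absolute value is at most half of the total. *)
Lemma edge_vector_le1 (V : finType) (c : V -> int) (v : V) :
  edge_vector c -> `|c v| <= 1.
Proof.
case=> + +; rewrite (bigD1 v) //= [in X in _ -> X](bigD1 v) //=.
have half (x r n : int) : `|r| <= n -> x + r = 0 -> `|x| + n <= 2 -> `|x| <= 1.
  by lia.
exact: half (ler_norm_sum _ _ _).
Qed.

(** Splitting off at [v]: once the signs make the entries at [v] cancel, each
    vector retains norm at most 1 outside [v]. *)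
Lemma edge_vector_split (V : finType) (c1 c2 : V -> int) (v : V) :
  edge_vector c1 -> edge_vector c2 -> c1 v != 0 -> c2 v != 0 ->
  exists s : bool, edge_vector (fun w => c1 w + (-1) ^+ s * c2 w).
Proof.
move=> c1E c2E c1v c2v.
have c1v1 := edge_vector_le1 v c1E; have c2v1 := edge_vector_le1 v c2E.
(* Both entries are 1 or -1, so the sign is negative when they agree. *)
exists (c1 v == c2 v); set s := (c1 v == c2 v).
case: c1E c2E => [sum1 norm1] [sum2 norm2]; split.
  by rewrite big_split /= -mulr_sumr sum1 sum2 mulr0 addr0.
have cancel_v : c1 v + (-1) ^+ s * c2 v = 0.
  by rewrite /s; case: eqVneq => ? /=; lia.
rewrite (bigD1 v) //= cancel_v normr0 add0r.
apply: (@le_trans _ _ (\sum_(w | w != v) (`|c1 w| + `|c2 w|))).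
  apply: ler_sum => w _; apply: le_trans (ler_normD _ _) _.
  by rewrite normrM normr_sign mul1r.
have tails (a b x y : int) :
  1 <= a -> 1 <= b -> a + x <= 2 -> b + y <= 2 -> x + y <= 2 by lia.
move: norm1 norm2.
rewrite big_split /= (bigD1 v) //= [in X in _ -> X](bigD1 v) //=.
by apply: tails; lia.
Qed.

(** Induction on the number of vectors.  Two vectors of [A] that are nonzero at
    the same [v] are merged by [edge_vector_split]; if there is no such pair,
    each coordinate of the signed sum has at most one nonzero term. *)
Lemma balanced_signing (E V : finType) (A : {set E}) (c : E -> V -> int) :
  (forall e, e \in A -> edge_vector (c e)) ->
  exists sigma : E -> bool,
    forall v, `|\sum_(e in A) (-1) ^+ sigma e * c e v| <= 1.
Proof.
have [n] := ubnP #|A|; elim: n A c => // n IHn A c; rewrite ltnS => leAn cE.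
have [|no_meet] := pselect (exists e1 e2 v,
  [/\ e1 \in A, e2 \in A, e1 != e2, c e1 v != 0 & c e2 v != 0]).
  case=> e1 [e2 [v [e1A e2A e12 c1v c2v]]].
  have [s sE] := edge_vector_split (cE _ e1A) (cE _ e2A) c1v c2v.
  pose c' e w := if e == e1 then c e1 w + (-1) ^+ s * c e2 w else c e w.
  have [||sigma sigmaP] := IHn (A :\ e2)%SET c'.
  - by move: leAn; rewrite (cardsD1 e2) e2A.
  - move=> e; rewrite !inE => /andP[_ eA]; rewrite /c'.
    by case: eqP => // _; exact: cE.
  (* [e2] is oriented along with the merged edge, up to the sign used in the
     merging. *)
  exists (fun e => if e == e2 then s (+) sigma e1 else sigma e) => w.
  have e1A2 : e1 \in (A :\ e2)%SET by rewrite !inE e12.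
  move: (sigmaP w); rewrite (big_setD1 e2 e2A) /= eqxx.
  rewrite (big_setD1 e1 e1A2) [in X in _ -> X](big_setD1 e1 e1A2) /=.
  rewrite /c' eqxx (negPf e12) signr_addb mulrDr.
  rewrite (_ : \sum_(e in _) _ = \sum_(e in A :\ e2 :\ e1)
    (-1) ^+ (if e == e2 then s (+) sigma e1 else sigma e) * c e w); last first.
    apply: eq_bigr => e; rewrite !inE => /and3P[ne1 ne2 _].
    by rewrite (negPf ne1) (negPf ne2).
  by rewrite -addrA addrCA mulrA [(-1) ^+ sigma e1 * (-1) ^+ s]mulrC.
exists (fun=> false) => v.
have [e0 /andP[e0A ce0] | none] := pickP [pred e | (e \in A) && (c e v != 0)].
  rewrite (bigD1 e0) //= big1 ?addr0 => [|e /andP[eA ne]].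
    by rewrite expr0 mul1r; apply: edge_vector_le1; exact: cE.
  apply/eqP; rewrite expr0 mul1r; apply: contra_notT no_meet => ce.
  by exists e, e0, v.
rewrite big1 ?normr0 // => e eA; apply/eqP.
by have := none e; rewrite /= eA /= expr0 mul1r => /negbFE.
Qed.

End Signing.

(** * Balanced orientations *)

Section Balanced.
Local Open Scope ring_scope.

(** The right-hand side is outdegree minus indegree; on the left the indegree is
    eliminated by writing it as [deg v - outdeg D v]. *)
Lemma outdeg_sub_indeg (G : multigraph) (D : orientation G) (v : vertex G) :
  (2 * outdeg D v)%:Z - (deg v)%:Z =
  \sum_e ((v == tail D e)%:Z - (v == Defs.head D e)%:Z).
Proof.
have outE : (outdeg D v)%:Z = \sum_e (v == tail D e)%:Z.
  rewrite /outdeg -sum1_card big_mkcond /= -natz natr_sum.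
  by apply: eq_bigr => e _; rewrite inE eq_sym; case: eqP.
have degE : (deg v)%:Z = \sum_e ((v == tail D e)%:Z + (v == Defs.head D e)%:Z).
  rewrite /deg -sum1_card big_mkcond /= -natz natr_sum; apply: eq_bigr => e _.
  rewrite inE; have := card_ends e; rewrite (orient_ends D e) cards2 !inE.
  by case: (eqVneq v (tail D e)) => [<-|_]; case: (eqVneq v).
rewrite PoszM outE degE mulr_sumr -sumrB; apply: eq_bigr => e _; lia.
Qed.

Lemma edge_vector_delta (V : finType) (x y : V) :
  edge_vector (fun v => (v == x)%:Z - (v == y)%:Z).
Proof.
have sum_delta (z : V) : \sum_v (v == z)%:Z = 1.
  by rewrite (bigD1 z) //= eqxx big1 ?addr0 // => v /negPf ->.
split; first by rewrite sumrB !sum_delta subrr.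
apply: (@le_trans _ _ (\sum_v ((v == x)%:Z + (v == y)%:Z))).
  by apply: ler_sum => v _; lia.
by rewrite big_split /= !sum_delta.
Qed.

(** Fix an arbitrary orientation and reverse the edges that receive a negative
    sign in a balanced signing. *)
Lemma balanced_orientation (G : multigraph) :
  exists D : orientation G,
    forall v, ((deg v).-1 <= 2 * outdeg D v <= (deg v).+1)%N.
Proof.
have /choice[xy xyE] (e : edge G) :
    exists xy : vertex G * vertex G, ends e = [set xy.1; xy.2]%SET.
  have /eqP/cards2P[x [y [_ ->]]] := card_ends e; by exists (x, y).
pose c e v : int := (v == (xy e).1)%:Z - (v == (xy e).2)%:Z.
have [sigma sigmaP] := @balanced_signing _ _ [set: edge G]%SET c
  (fun e _ => edge_vector_delta (xy e).1 (xy e).2).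
have DE e : ends e = [set if sigma e then (xy e).2 else (xy e).1;
                          if sigma e then (xy e).1 else (xy e).2]%SET.
  by rewrite xyE; case: (sigma e) => //; rewrite finset.setUC.
exists (Orientation DE) => v.
have := sigmaP v; rewrite (eq_bigr (fun e =>
  (v == tail (Orientation DE) e)%:Z - (v == Defs.head (Orientation DE) e)%:Z)).
  rewrite (eq_bigl xpredT) => [|e]; last by rewrite inE.
  by rewrite -outdeg_sub_indeg; lia.
move=> e _; rewrite /c /=; case: (sigma e); last by rewrite expr0 mul1r.
by rewrite expr1 mulN1r opprB.
Qed.

End Balanced.

(** * Holes *)

Section Holes.
Local Open Scope classical_set_scope.

(** The hole containing [k] is found by extending [{k}] as far as possible in
    each direction. *)
Lemma hole_containing (G : multigraph) (F : vertex G -> set nat)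
    (v : vertex G) (k : nat) :
  k <= deg v -> F v k -> exists I, hole F v I /\ I k.
Proof.
move=> lekd Fk.
pose left a := `[< a <= k /\ forall i, a <= i <= k -> F v i >].
pose right b := `[< k <= b <= deg v /\ forall i, k <= i <= b -> F v i >].
have left_k : exists a, left a.
  by exists k; apply/asboolP; split=> // i; rewrite -eqn_leq => /eqP <-.
have right_k : exists b, right b.
  exists k; apply/asboolP; split=> [|i]; first by rewrite leqnn.
  by rewrite -eqn_leq => /eqP <-.
have right_ub b : right b -> b <= deg v by move=> /asboolP[/andP[]].
case: (ex_minnP left_k) => a /asboolP[leak Fa] amin.
case: (ex_maxnP right_k right_ub) => b /asboolP[/andP[lekb lebd] Fb] bmax.
exists [set i | a <= i <= b]; split; last by rewrite /= leak.
split.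
- by exists a, b; split=> //; rewrite (leq_trans leak).
- move=> i /= /andP[leai leib]; case: (leqP i k) => [leik|/ltnW leki].
    by apply: Fa; rewrite leai.
  by apply: Fb; rewrite leki.
move=> J [a' [b' [/andP[leab' lebd'] ->]]] subF subJ.
have /andP[lea'a _] : a' <= a <= b'.
  by apply: subJ; rewrite /= leqnn (leq_trans leak).
have /andP[_ lebb'] : a' <= b <= b'.
  by apply: subJ; rewrite /= leqnn (leq_trans leak).
have leaa' : a <= a'.
  apply: amin; apply/asboolP; split; first exact: leq_trans leak.
  by move=> i hi; apply: subF => /=; lia.
have leb'b : b' <= b.
  apply: bmax; apply/asboolP; split; first by lia.
  by move=> i hi; apply: subF => /=; lia.
by apply/seteqP; split=> i /=; lia.
Qed.

(** The hole of [k] contains [k] and one of [0] and [deg v], hence everything in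
    between. *)
Lemma hole_end_segment (G : multigraph) (F : vertex G -> set nat)
    (v : vertex G) (k : nat) :
  (forall I, hole F v I -> end_interval F v I) -> k <= deg v -> F v k ->
  (forall i, i <= k -> F v i) \/ (forall i, k <= i <= deg v -> F v i).
Proof.
move=> holes_end lekd Fk.
have [I [holeI Ik]] := hole_containing lekd Fk.
have [_ endI] := holes_end I holeI.
case: holeI => [[a [b [_ IE]]] subF _]; move: Ik endI subF; rewrite {}IE /=.
by move=> kab [h|h] subF; [left|right] => i hi; apply: subF => /=; lia.
Qed.

Lemma segment_card_le (A : set nat) (m n : nat) :
  finite_set A -> (forall i, m <= i < m + n -> A i) -> n <= #|` fset_set A|.
Proof.
move=> finA subA; rewrite -{1}(size_iota m n).
apply: uniq_leq_size (iota_uniq m n) _ => i; rewrite mem_iota => /subA Ai.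
by rewrite in_fset_set //; exact: mem_set.
Qed.

End Holes.

Theorem theorem7 (G : multigraph) (F : vertex G -> set nat)
  (F_half : forall v : vertex G, card_le_half (F v) (deg v))
  (holes_end : forall (v : vertex G) (I : set nat),
     hole F v I -> end_interval F v I) :
  exists D : orientation G, avoiding F D.
Proof.
have [D D_balanced] := balanced_orientation G.
exists D => v Fout; have [finF Fle] := F_half v.
have le_out_deg : outdeg D v <= deg v.
  apply: subset_leq_card; apply/fintype.subsetP => e; rewrite !inE => /eqP <-.
  by rewrite (orient_ends D e) !inE eqxx.
have := D_balanced v.
have [low|high] := hole_end_segment (holes_end v) le_out_deg Fout.
  have := @segment_card_le _ 0 (outdeg D v).+1 finF low; lia.
have := @segment_card_le _ (outdeg D v) (deg v - outdeg D v).+1 finF.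
have -> : (outdeg D v + (deg v - outdeg D v).+1 = (deg v).+1)%N by lia.
by move=> /(_ high); lia.
Qed.
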